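(* Let $K$ be an oriented Legendrian knot with rotation number $r=rot(K)$, let $T(K)$ be its underlying topological knot, and let $(X,\ast,u,u^{-1})$ be a finite GL-quandle. Then $$\operatorname{Col}_X\bigl(S_{-\operatorname{sgn}(r)}^{|r|}(K)\bigr)=\operatorname{Col}_X\bigl(T(K)\bigr),$$ where $S_{-\operatorname{sgn}(r)}^{|r|}(K)$ denotes $|r|$ negative stabilizations of $K$ if $r>0$, $|r|$ positive stabilizations if $r<0$, and $K$ itself if $r=0$.
   Context: A rack is a set $X$ with a binary operation $\ast$ such that for every $y\in X$ the map $x\mapsto x\ast y$ is a bijection of $X$ and $(x\ast y)\ast z=(x\ast z)\ast(y\ast z)$ for all $x,y,z$; it is a quandle if also $x\ast x=x$. A GL-rack is a quadruple $(X,\ast,u,d)$ where $(X,\ast)$ is a rack and $u,d\colon X\to X$ are maps such that for all $x,y\in X$: $u(d(x\ast x))=d(u(x\ast x))=x$; $u(x\ast y)=u(x)\ast y$ and $d(x\ast y)=d(x)\ast y$; $x\ast u(y)=x\ast d(y)=x\ast y$. A GL-quandle is a GL-rack with $x\ast x=x$ for all $x$ (then $d=u^{-1}$). Legendrian knots lie in $(\mathbb{R}^3,\xi_{\mathrm{std}})$, $\xi_{\mathrm{std}}=\mathrm{span}\{\partial_y,\partial_x+y\partial_z\}$, and are represented by oriented front diagrams. For a front diagram $D$ with $u(D)$ cusps traversed upward and $d(D)$ traversed downward, $rot(K)=\frac12(d(D)-u(D))$. Positive/negative stabilization $S_\pm$ (inserting a zigzag) changes $rot$ by $\pm1$. Given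 a finite GL-rack $X$, a coloring of $D$ is an assignment of elements of $X$ to the semi-arcs of $D$ (segments bounded by undercrossings or cusps) such that, following the orientation through a cusp, the color changes from $x$ to $u(x)$ if the cusp is traversed upward and to $d(x)$ if traversed downward; and at each crossing whose over-strand is colored $y$, if the under semi-arc on the right of the oriented over-strand is colored $x$, the one on its left is colored $x\ast y$. $\operatorname{Col}_X(K)$ is the number of colorings (a Legendrian isotopy invariant). For a topological knot $T$, $\operatorname{Col}_X(T)$ denotes the usual quandle coloring number of $T$ by the quandle $(X,\ast)$: the number of assignments of elements of $X$ to the arcs of an oriented diagram of $T$ such that at each crossing with over-arc colored $y$, the under-arc on the right of the oriented over-arc colored $x$ forces the under-arc on its left to be colored $x\ast y$; equivalently $|\operatorname{Hom}(Q(T),X)|$ for the knot quandle $Q(T)$. *)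

(* Defs.v *)
From mathcomp Require Import all_boot all_algebra.

Set Implicit Arguments.
Unset Strict Implicit.
Unset Printing Implicit Defensive.

Definition is_rack (X : Type) (op : X -> X -> X) : Prop :=
  (forall y, bijective (fun x => op x y)) /\
  (forall x y z, op (op x y) z = op (op x z) (op y z)).

Definition is_GL_rack (X : Type) (op : X -> X -> X) (u d : X -> X) : Prop :=
  is_rack op /\
  (forall x, u (d (op x x)) = x /\ d (u (op x x)) = x) /\
  (forall x y, u (op x y) = op (u x) y /\ d (op x y) = op (d x) y) /\
  (forall x y, op x (u y) = op x y /\ op x (d y) = op x y).

Definition is_GL_quandle (X : Type) (op : X -> X -> X) (u d : X -> X) : Prop :=
  is_GL_rack op u d /\ (forall x, op x x = x).

(* A generic front is read from left to right.  Between consecutive    *)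
(* elementary pieces is a vertical "slice" meeting the front in        *)
(* finitely many strands, numbered 0,1,... from bottom to top; a slice *)
(* is recorded by the orientations of its strands (true = pointing     *)
(* right).  Elementary pieces:                                         *)
(*   LCusp i b : a left cusp born at height i; new strands i (lower,   *)
(*               orientation b) and i+1 (upper, orientation ~~ b).     *)
(*   RCusp i   : a right cusp joining strands i and i+1.               *)
(*   Cross i   : strands i and i+1 cross.  Front convention: the strand *)
(*               of smaller slope (going from i+1 down to i) is over.  *)

Inductive piece := LCusp of nat & bool | RCusp of nat | Cross of nat.

Definition front := seq piece.

Definition apply_piece (s : seq bool) (g : piece) : seq bool :=
  match g with
  | LCusp i b => take i s ++ [:: b; ~~ b] ++ drop i s
  | RCusp i => take i s ++ drop i.+2 s
  | Cross i => take i s ++ [:: nth false s i.+1; nth false s i] ++ drop i.+2 s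
  end.

Definition piece_ok (s : seq bool) (g : piece) : bool :=
  match g with
  | LCusp i _ => i <= size s
  | RCusp i => (i.+1 < size s) && (nth false s i != nth false s i.+1)
  | Cross i => i.+1 < size s
  end.

Definition slice (D : front) (k : nat) : seq bool :=
  foldl apply_piece [::] (take k D).

Definition piece_at (D : front) (k : nat) : piece := nth (Cross 0) D k.

Definition valid_front (D : front) : bool :=
  all (fun k => piece_ok (slice D k) (piece_at D k)) (iota 0 (size D)) &&
  (slice D (size D) == [::]).

(* strand segments (k, j): strand j of slice k *)
Definition point (D : front) :=
  {p : 'I_(size D).+1 * 'I_((size D).*2.+1) | p.2 < size (slice D p.1)}.

Definition pt (D : front) (k j : nat) : option (point D) :=
  match (insub k : option 'I_(size D).+1), (insub j : option 'I_((size D).*2.+1)) with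
  | Some k', Some j' => insub (k', j')
  | _, _ => None
  end.

Section Coloring.
Variables (X : finType) (op : X -> X -> X).

Definition oop (a b : option X) : option X :=
  match a, b with Some x, Some y => Some (op x y) | _, _ => None end.

(* Local coloring condition across one piece; C0/C1 are the colors on
   the slices just before/after the piece; cusps act by fu (upward
   traversal) and fd (downward traversal). *)
Definition piece_col_ok (fu fd : X -> X) (s : seq bool) (g : piece)
    (C0 C1 : nat -> option X) : bool :=
  match g with
  | LCusp i b =>
      all (fun j => C1 (if j < i then j else j.+2) == C0 j) (iota 0 (size s)) &&
      (if b then C1 i == omap fd (C1 i.+1)   (* traversed downward *)
            else C1 i.+1 == omap fu (C1 i))  (* traversed upward *)
  | RCusp i =>
      all (fun j => (j == i) || (j == i.+1) ||
                    (C1 (if j < i then j else j - 2) == C0 j)) (iota 0 (size s)) &&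
      (if nth false s i then C0 i.+1 == omap fu (C0 i)   (* upward *)
                        else C0 i == omap fd (C0 i.+1))  (* downward *)
  | Cross i =>
      all (fun j => (j == i) || (j == i.+1) || (C1 j == C0 j)) (iota 0 (size s)) &&
      (* over-strand: from (k, i+1) to (k+1, i), one semi-arc *)
      (C1 i == C0 i.+1) &&
      (* under semi-arcs (k,i) [lower left] and (k+1,i+1) [upper right]:
         the one on the right of the oriented over-strand is x, the
         one on its left is x * y *)
      (if nth false s i.+1 then C1 i.+1 == oop (C0 i) (C0 i.+1)
                           else C0 i == oop (C1 i.+1) (C0 i.+1))
  end.

Definition col (D : front) (c : {ffun point D -> X}) (k j : nat) : option X :=
  omap c (pt D k j).

Definition coloring_ok (fu fd : X -> X) (D : front) (c : {ffun point D -> X}) : bool :=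
  all (fun k => piece_col_ok fu fd (slice D k) (piece_at D k) (col c k) (col c k.+1))
      (iota 0 (size D)).

Definition ColLeg (u d : X -> X) (D : front) : nat :=
  #|[set c : {ffun point D -> X} | coloring_ok u d c]|.

(* Col_X(T(K)): usual quandle coloring number of the underlying
   topological knot, computed on the knot diagram given by the front
   (cusps smoothed, i.e. acting trivially). *)
Definition ColTop (D : front) : nat :=
  #|[set c : {ffun point D -> X} | coloring_ok id id c]|.

End Coloring.

Definition link_step (D : front) (k j k' j' : nat) : bool :=
  (k' == k.+1) && (k < size D) && (j < size (slice D k)) &&
  match piece_at D k with
  | LCusp i _ => j' == (if j < i then j else j.+2)
  | RCusp i => (j != i) && (j != i.+1) && (j' == (if j < i then j else j - 2))
  | Cross i => j' == (if j == i then i.+1 else if j == i.+1 then i else j)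
  end.

Definition cusp_pair (D : front) (k j j' : nat) : bool :=
  ((0 < k) && (if piece_at D k.-1 is LCusp i _ then (j == i) && (j' == i.+1) else false))
  || ((k < size D) && (if piece_at D k is RCusp i then (j == i) && (j' == i.+1) else false)).

Definition adj (D : front) : rel (point D) := fun p q =>
  let k := nat_of_ord (val p).1 in let j := nat_of_ord (val p).2 in
  let k' := nat_of_ord (val q).1 in let j' := nat_of_ord (val q).2 in
  [|| link_step D k j k' j', link_step D k' j' k j,
      (k == k') && cusp_pair D k j j' | (k == k') && cusp_pair D k j' j].

Definition knot_front (D : front) : bool :=
  valid_front D && (0 < size D) &&
  [forall p : point D, forall q : point D, connect (@adj D) p q].

Definition piece_up (s : seq bool) (g : piece) : bool :=
  match g with LCusp _ b => ~~ b | RCusp i => nth false s i | Cross _ => false end.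

Definition piece_down (s : seq bool) (g : piece) : bool :=
  match g with LCusp _ b => b | RCusp i => ~~ nth false s i | Cross _ => false end.

Definition n_up (D : front) : nat :=
  count (fun k => piece_up (slice D k) (piece_at D k)) (iota 0 (size D)).
Definition n_down (D : front) : nat :=
  count (fun k => piece_down (slice D k) (piece_at D k)) (iota 0 (size D)).

Definition rot_num (D : front) : int := (((n_down D)%:Z - (n_up D)%:Z) %/ 2)%Z.

(* Stabilization: insert a zigzag on strand j of slice k.              *)
(* eps = true : positive stabilization S_+ (rot increases by 1),      *)
(* eps = false: negative stabilization S_- (rot decreases by 1).      *)

Definition stab (eps : bool) (k j : nat) (D : front) : front :=
  let b := nth false (slice D k) j in
  take k D ++
  (if eps == b then [:: LCusp j b; RCusp j.+1]      (* zigzag below the strand *)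
               else [:: LCusp j.+1 (~~ b); RCusp j]) (* zigzag above the strand *)
  ++ drop k D.

Inductive stabilized (eps : bool) : nat -> front -> front -> Prop :=
| stab0 D : stabilized eps 0 D D
| stabS n D D' k j :
    stabilized eps n D D' -> k <= size D' -> j < size (slice D' k) ->
    stabilized eps n.+1 D (stab eps k j D').

(* Main.v *)
Require Import Defs.
From mathcomp Require Import all_boot all_algebra.
From mathcomp Require Import zify.

(* Since [u] commutes with [op] and acts trivially in the second argument, twisting a
   colouring [c] by [u ^ h] turns topological colourings into Legendrian ones as soon as
   [h] is a Maslov potential: constant along strands and one larger on the upper than on
   the lower strand of every cusp.  Travelling once around the knot, [h] changes by
   (number of up cusps) - (number of down cusps), so a potential exists on a knot of
   rotation number 0, which is what the stabilizations achieve; they do not change the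
   topological colourings.  Connectedness of the stabilized front is obtained from the
   same invariance: a front is connected iff it has at most two colourings by the trivial
   quandle with two elements. *)

Set Implicit Arguments.
Unset Strict Implicit.
Unset Printing Implicit Defensive.

(* [col] is also the name of a matrix operation. *)
Local Notation col := Defs.col.

(** * Slices and points of a front *)

Section Slices.
Implicit Types (s : seq bool) (g : piece) (D : front).

Lemma size_LCusp s i b : size (apply_piece s (LCusp i b)) = (size s).+2.
Proof. by rewrite /= size_cat /= -[in RHS](cat_take_drop i s) size_cat; lia. Qed.

Lemma size_RCusp s i : i.+1 < size s -> size (apply_piece s (RCusp i)) = size s - 2.
Proof. by move=> /= lt; rewrite size_cat size_take size_drop ifT; lia. Qed.

Lemma size_Cross s i : i.+1 < size s -> size (apply_piece s (Cross i)) = size s.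
Proof. by move=> /= lt; rewrite size_cat /= size_take size_drop ifT; lia. Qed.

Lemma nth_LCusp s i b j : i <= size s ->
  nth false (apply_piece s (LCusp i b)) j =
  if j < i then nth false s j else if j == i then b else
  if j == i.+1 then ~~ b else nth false s (j - 2).
Proof.
move=> le_is /=; rewrite nth_cat size_takel //.
case: ltnP => [lt_ji|le_ij]; first by rewrite nth_take.
case: eqP => [->|ne_ji]; first by rewrite subnn.
case: eqP => [->|ne_ji1]; first by rewrite subSnn.
have -> : j - i = (j - i.+2).+2 by lia.
by rewrite /= nth_drop; congr nth; lia.
Qed.

Lemma nth_RCusp s i j : i.+1 < size s ->
  nth false (apply_piece s (RCusp i)) j = nth false s (if j < i then j else j.+2).
Proof.
move=> lt_is /=; rewrite nth_cat size_takel; last by lia.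
case: ltnP => [lt_ji|le_ij]; first by rewrite nth_take.
by rewrite nth_drop; congr nth; lia.
Qed.

Definition swap i j := if j == i then i.+1 else if j == i.+1 then i else j.

Lemma nth_Cross s i j : i.+1 < size s ->
  nth false (apply_piece s (Cross i)) j = nth false s (swap i j).
Proof.
move=> lt_is; rewrite /swap /= nth_cat size_takel; last by lia.
case: ltnP => [lt_ji|le_ij].
  by rewrite nth_take // !ifF //; lia.
case: eqP => [->|ne_ji]; first by rewrite subnn.
case: eqP => [->|ne_ji1]; first by rewrite subSnn.
have -> : j - i = (j - i.+2).+2 by lia.
by rewrite /= nth_drop; congr nth; lia.
Qed.

Lemma size_apply_le s g : size (apply_piece s g) <= (size s).+2.
Proof.
case: g => [i b|i|i]; first by rewrite size_LCusp.
  by rewrite /= size_cat size_take_min size_drop; lia.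
by rewrite /= size_cat /= size_take_min size_drop; lia.
Qed.

Lemma slice0 D : slice D 0 = [::].
Proof. by rewrite /slice take0. Qed.

Lemma sliceS D k : k < size D -> slice D k.+1 = apply_piece (slice D k) (piece_at D k).
Proof. by move=> lt; rewrite /slice (take_nth (Cross 0)) // foldl_rcons. Qed.

Lemma size_slice_le D k : k <= size D -> size (slice D k) <= k.*2.
Proof.
elim: k => [|k IH] lt; first by rewrite slice0.
by rewrite sliceS //; have := size_apply_le (slice D k) (piece_at D k); have := IH (ltnW lt); lia.
Qed.

Lemma valid_piece D k : valid_front D -> k < size D ->
  piece_ok (slice D k) (piece_at D k).
Proof. by case/andP => /allP H _ lt; apply: H; rewrite mem_iota. Qed.

Lemma valid_last D : valid_front D -> slice D (size D) = [::].
Proof. by case/andP => _ /eqP. Qed.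

End Slices.

Section Points.
Variable D : front.
Implicit Types p q : point D.

Definition pk p : nat := (val p).1.
Definition pj p : nat := (val p).2.

Lemma pk_le p : pk p <= size D.
Proof. by rewrite -ltnS /pk. Qed.

Lemma pj_lt p : pj p < size (slice D (pk p)).
Proof. exact: valP p. Qed.

Lemma point_eq p q : pk p = pk q -> pj p = pj q -> p = q.
Proof.
rewrite /pk /pj => e1 e2; apply: val_inj; move: e1 e2.
by case: (val p) => a b; case: (val q) => a' b' /= /val_inj -> /val_inj ->.
Qed.

(** Each piece adds at most two strands, so a slice of [D] has at most twice [size D] of them. The
    ordinal range in [point] therefore cuts off no strand. *)
Lemma strand_bound k j : k <= size D -> j < size (slice D k) -> j < (size D).*2.+1.
Proof. by move=> le_k lt_j; have := size_slice_le le_k; lia. Qed.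

Definition mkpt k j (le_k : k <= size D) (lt_j : j < size (slice D k)) : point D :=
  exist _ (Ordinal (le_k : k < (size D).+1), Ordinal (strand_bound le_k lt_j)) lt_j.

Lemma pk_mkpt k j (le_k : k <= size D) (lt_j : j < size (slice D k)) :
  pk (mkpt le_k lt_j) = k.
Proof. by []. Qed.

Lemma pj_mkpt k j (le_k : k <= size D) (lt_j : j < size (slice D k)) :
  pj (mkpt le_k lt_j) = j.
Proof. by []. Qed.

Lemma ptE k j (le_k : k <= size D) (lt_j : j < size (slice D k)) :
  pt D k j = Some (mkpt le_k lt_j).
Proof.
rewrite /pt; case: insubP => [k' _ ek|]; last by rewrite ltnS le_k.
case: insubP => [j' _ ej|]; last by rewrite (strand_bound le_k lt_j).
case: insubP => [p _ ep|]; last by rewrite /= ek ej lt_j.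
by congr Some; apply: point_eq; rewrite /pk /pj ep.
Qed.

Lemma pt_point p : pt D (pk p) (pj p) = Some p.
Proof. by rewrite (ptE (pk_le p) (pj_lt p)); congr Some; apply: point_eq. Qed.

Lemma pt_inv k j p : pt D k j = Some p -> k = pk p /\ j = pj p.
Proof.
rewrite /pt; case: insubP => [k' _ ek|//]; case: insubP => [j' _ ej|//].
by case: insubP => [p' _ ep [<-]|//]; rewrite /pk /pj ep.
Qed.

Lemma pt_None k j : (k <= size D) && (j < size (slice D k)) = false -> pt D k j = None.
Proof.
case e: pt => [p|//]; have [-> ->] := pt_inv e.
by rewrite pk_le pj_lt.
Qed.

End Points.

Arguments apply_piece : simpl never.
Arguments piece_at : simpl never.

(** * Colourings and Maslov potentials *)

Section Colorings.
Variables (X : finType) (op : X -> X -> X).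
Implicit Types (s : seq bool) (g : piece) (D : front).

Lemma col_point D (c : {ffun point D -> X}) p : col c (pk p) (pj p) = Some (c p).
Proof. by rewrite /col pt_point. Qed.

Lemma col_None D (c : {ffun point D -> X}) k j :
  (k <= size D) && (j < size (slice D k)) = false -> col c k j = None.
Proof. by move=> /pt_None e; rewrite /col e. Qed.

Lemma col_inrange D (c : {ffun point D -> X}) k j (le_k : k <= size D)
  (lt_j : j < size (slice D k)) : col c k j = Some (c (mkpt le_k lt_j)).
Proof. by rewrite /col ptE. Qed.

Lemma coloring_okP fu fd D (c : {ffun point D -> X}) :
  reflect (forall k, k < size D ->
    piece_col_ok op fu fd (slice D k) (piece_at D k) (col c k) (col c k.+1))
  (coloring_ok op fu fd c).
Proof.
apply: (iffP allP) => H k lt_k; first by apply: H; rewrite mem_iota.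
by apply: H; move: lt_k; rewrite mem_iota.
Qed.

Lemma eq_piece_col fu fd s g C0 C1 C0' C1' : C0 =1 C0' -> C1 =1 C1' ->
  piece_col_ok op fu fd s g C0 C1 = piece_col_ok op fu fd s g C0' C1'.
Proof.
move=> e0 e1; case: g => [i b|i|i] /=; rewrite ?e0 ?e1; congr (_ && _) => //;
  try (congr (_ && _)); apply: eq_all => j; by rewrite e0 e1.
Qed.

Lemma omap_id (a : option X) : omap id a = a. Proof. by case: a. Qed.

(** With identity maps at the cusps, both orientations impose the same equation between the two
    branches, so [b] drops out of the condition. *)
Lemma LCusp_col_okP s i b C0 C1 :
  reflect ((forall j, j < size s -> C1 (if j < i then j else j.+2) = C0 j) /\ C1 i = C1 i.+1)
          (piece_col_ok op id id s (LCusp i b) C0 C1).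
Proof.
rewrite /= !omap_id [C1 i.+1 == _]eq_sym if_same.
apply: (iffP andP) => [[/allP H /eqP e]|[H e]]; split => //.
- by move=> j lt; apply/eqP/H; rewrite mem_iota.
- by apply/allP => j; rewrite mem_iota => lt; apply/eqP/H.
- exact/eqP.
Qed.

Lemma RCusp_col_okP s i C0 C1 :
  reflect ((forall j, j < size s -> j != i -> j != i.+1 ->
              C1 (if j < i then j else j - 2) = C0 j) /\ C0 i = C0 i.+1)
          (piece_col_ok op id id s (RCusp i) C0 C1).
Proof.
rewrite /= !omap_id [C0 i.+1 == _]eq_sym if_same.
apply: (iffP andP) => [[/allP H /eqP e]|[H e]]; split => //.
- move=> j lt n1 n2; apply/eqP; have := H j; rewrite mem_iota (negPf n1) (negPf n2); exact.
- apply/allP => j; rewrite mem_iota => lt.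
  by case: eqP => //= /eqP n1; case: eqP => //= /eqP n2; apply/eqP/H.
- exact/eqP.
Qed.

End Colorings.

(** Here [n] counts the strands before the piece, and [z] is the jump from the lower to the upper
    branch of a cusp. A crossing just exchanges the two values, whichever strand is over. Values lie
    in [nat] so that they can serve as exponents of [u]. *)
Definition potential_step z n g (h0 h1 : nat -> nat) : Prop :=
  match g with
  | LCusp i _ => (forall j, j < n -> h1 (if j < i then j else j.+2) = h0 j) /\
                 h1 i.+1 = h1 i + z
  | RCusp i => (forall j, j < n -> j != i -> j != i.+1 ->
                  h1 (if j < i then j else j - 2) = h0 j) /\ h0 i.+1 = h0 i + z
  | Cross i => (forall j, j < n -> j != i -> j != i.+1 -> h1 j = h0 j) /\
               h1 i = h0 i.+1 /\ h1 i.+1 = h0 i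
  end.

Definition potential z D (h : nat -> nat -> nat) : Prop :=
  forall k, k < size D -> potential_step z (size (slice D k)) (piece_at D k) (h k) (h k.+1).

Section Twist.
Variables (X : finType) (op : X -> X -> X) (u d : X -> X).
Hypothesis GL : is_GL_quandle op u d.

Let uK : cancel u d.
Proof. by move=> x; case: GL => -[_ [H _]] id_op; have [_] := H x; rewrite id_op. Qed.

Let u_inj : injective u. Proof. exact: can_inj uK. Qed.
Let iter_inj m : injective (iter m u).
Proof. by elim: m => [|m IH] x y //= /u_inj /IH. Qed.

Let op_iter m n x y : op (iter m u x) (iter n u y) = iter m u (op x y).
Proof.
case: GL => -[_ [_ [Hl Hr]]] _.
have -> : op (iter m u x) (iter n u y) = op (iter m u x) y.
  by elim: n => //= n <-; have [] := Hr (iter m u x) (iter n u y).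
by elim: m => //= m <-; have [] := Hl (iter m u x) y.
Qed.

Let omap_iter_eq m (a b : option X) :
  (omap (iter m u) a == omap (iter m u) b) = (a == b).
Proof.
by apply/eqP/eqP => [|-> //]; case: a b => [a|] [b|] //= [] /iter_inj ->.
Qed.

Let omap_d m (a : option X) : omap d (omap (iter m.+1 u) a) = omap (iter m u) a.
Proof. by case: a => //= x; rewrite uK. Qed.

Let omap_u m (a : option X) : omap u (omap (iter m u) a) = omap (iter m.+1 u) a.
Proof. by case: a. Qed.

Let oop_iter m n (a b : option X) :
  oop op (omap (iter m u) a) (omap (iter n u) b) = omap (iter m u) (oop op a b).
Proof. by case: a b => [a|] [b|] //=; rewrite op_iter. Qed.

(** At a cusp the upper branch carries one more [u] than the lower one, which is exactly what [u] or
    [d] accounts for in the Legendrian condition. At a crossing both sides carry the exponent of the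
    under-strand. In each equation the common power of [u] cancels by injectivity. *)
Lemma twist_piece s g C0 C1 h0 h1 : potential_step 1 (size s) g h0 h1 ->
  piece_col_ok op u d s g (fun j => omap (iter (h0 j) u) (C0 j))
                          (fun j => omap (iter (h1 j) u) (C1 j))
  = piece_col_ok op id id s g C0 C1.
Proof.
case: g => [i b|i|i] /=.
- case=> H e; congr (_ && _).
    by apply: eq_in_all => j; rewrite mem_iota => lt; rewrite H // omap_iter_eq.
  by rewrite e addn1 omap_d omap_u !omap_id !omap_iter_eq.
- case=> H e; congr (_ && _).
    apply: eq_in_all => j; rewrite mem_iota => lt.
    by case: eqP => //= /eqP n1; case: eqP => //= /eqP n2; rewrite H // omap_iter_eq.
  by rewrite e addn1 omap_d omap_u !omap_id !omap_iter_eq.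
- case=> H [e e1]; congr (_ && _ && _).
  + apply: eq_in_all => j; rewrite mem_iota => lt.
    by case: eqP => //= /eqP n1; case: eqP => //= /eqP n2; rewrite H // omap_iter_eq.
  + by rewrite e omap_iter_eq.
  + by rewrite e1 !oop_iter !omap_iter_eq.
Qed.

Lemma ColLeg_maslov D h : potential 1 D h -> ColLeg op u d D = ColTop op D.
Proof.
move=> mh; pose F (c : {ffun point D -> X}) := [ffun p => iter (h (pk p) (pj p)) u (c p)].
have F_inj : injective F.
  by move=> c c' /ffunP e; apply/ffunP => p; have := e p; rewrite !ffunE => /iter_inj.
have colF c k j : col (F c) k j = omap (iter (h k j) u) (col c k j).
  by rewrite /col; case e: pt => [p|//] /=; rewrite ffunE; case: (pt_inv e) => -> ->.
(* [F] is an injective self-map of a finite type, so the preimage of the Legendrian colourings has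
   as many elements; it consists of the topological ones. *)
rewrite /ColLeg /ColTop -(card_preimset _ F_inj); apply: eq_card => c.
rewrite !inE; apply/coloring_okP/coloring_okP => H k lt_k; have := H k lt_k;
  by rewrite (eq_piece_col _ _ _ _ _ (colF c k) (colF c k.+1)) twist_piece //; apply: mh.
Qed.

End Twist.

(** * Stabilization *)

Definition zigzag (eps b : bool) j : piece * piece :=
  if eps == b then (LCusp j b, RCusp j.+1) else (LCusp j.+1 (~~ b), RCusp j).

(* The strand of the original slice carried by strand [j] after the birth of a
   zigzag on strand [i]; applied to slice numbers, the slice of [D] carried by slice [j] of
   a front stabilized at slice [i]. *)
Definition collapse i j := if j <= i then j else if j <= i.+2 then i else j - 2.

(** The right cusp joins the original strand to the adjacent newborn one. The other newborn strand
    survives, with the orientation of the original. *)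
Lemma zigzag_slice eps s i : i < size s ->
  let: (g1, g2) := zigzag eps (nth false s i) i in
  apply_piece (apply_piece s g1) g2 = s.
Proof.
move=> lt; rewrite /zigzag; case: ifP => _; apply: (@eq_from_nth _ false).
- by rewrite size_RCusp size_LCusp; lia.
- move=> j _; rewrite nth_RCusp ?size_LCusp ?nth_LCusp; try lia.
  case: (ltnP j i.+1) => lj; last by rewrite !ifF; try lia; congr nth; lia.
  case: ltnP => lj2 //; rewrite ifT; last by lia.
  by congr nth; lia.
- by rewrite size_RCusp size_LCusp; lia.
- move=> j _; rewrite nth_RCusp ?size_LCusp ?nth_LCusp; try lia.
  case: (ltnP j i) => lj; first by rewrite ifT //; lia.
  case: (ltnP j i.+1) => lj2.
    rewrite ifF; last by lia.
    rewrite ifF; last by lia.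
    rewrite ifT; last by lia.
    by rewrite negbK; congr nth; lia.
  by rewrite !ifF; try lia; congr nth; lia.
Qed.

(** Conditions that themselves contain a conditional are skipped, so nested conditionals are split
    from the inside out. *)
Ltac solve_index := rewrite ?/collapse;
  repeat match goal with |- context [if ?c then _ else _] =>
    lazymatch c with context [if _ then _ else _] => fail | _ => case: (boolP c) => ? end
  end; lia.

(** When cusps act trivially, the cusp equations give the three strands of the zigzag one colour,
    that of strand [i], and all other strands are merely renumbered. *)
Lemma zigzag_colP (X : finType) (op : X -> X -> X) eps b s i C0 C1 C2 : i < size s ->
  let: (g1, g2) := zigzag eps b i in
  piece_col_ok op id id s g1 C0 C1 /\
    piece_col_ok op id id (apply_piece s g1) g2 C1 C2 <->
  (forall j, j < size s -> C2 j = C0 j) /\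
  (forall j, j < (size s).+2 -> C1 j = C0 (collapse i j)).
Proof.
move=> lt_i; rewrite /zigzag; case: ifP => _; split.
(* The newborn pair lies below, so the original strand becomes strand [i.+2]. *)
- case=> /LCusp_col_okP[H1 e1] /RCusp_col_okP; rewrite size_LCusp => -[H2 e2].
  have Hi := H1 i lt_i; rewrite ltnn in Hi.
  have H3 j : j < (size s).+2 -> C1 j = C0 (collapse i j).
    move=> lt_j; case: (ltnP j i) => [lt|le].
      by rewrite -H1; [congr C1|]; solve_index.
    case: (eqVneq j i.+2) => [->|ne2]; first by rewrite Hi; congr C0; solve_index.
    case: (ltnP j i.+2) => [lt|le2]; last by rewrite -H1; [congr C1|]; solve_index.
    have -> : collapse i j = i by solve_index.
    by rewrite -Hi -e2; have [->|->] : j = i \/ j = i.+1 by solve_index.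
  split=> // j lt_j; case: (ltnP j i.+1) => [lt|le].
    have := H2 j; rewrite lt => ->; [|solve_index..].
    by rewrite H3; [congr C0|]; solve_index.
  have := H2 j.+2; have -> : (if j.+2 < i.+1 then j.+2 else j.+2 - 2) = j by solve_index.
  by move=> ->; [rewrite H3; [congr C0|]|..]; solve_index.
- case=> H2 H1; split.
    apply/LCusp_col_okP; split=> [j lt_j|].
      by rewrite H1; [congr C0|]; solve_index.
    by rewrite !H1; [congr C0|..]; solve_index.
  apply/RCusp_col_okP; rewrite size_LCusp; split=> [j lt_j n1 n2|].
    by rewrite H1 // H2; [congr C0|]; solve_index.
  by rewrite !H1; [congr C0|..]; solve_index.
(* The newborn pair lies above, so the original strand keeps its number [i]. *)
- case=> /LCusp_col_okP[H1 e1] /RCusp_col_okP; rewrite size_LCusp => -[H2 e2].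
  have Hi := H1 i lt_i; rewrite ltnSn in Hi.
  have H3 j : j < (size s).+2 -> C1 j = C0 (collapse i j).
    move=> lt_j; case: (ltnP j i.+1) => [lt|le].
      by rewrite -H1; [congr C1|]; solve_index.
    case: (ltnP j i.+3) => [lt|le2]; last by rewrite -H1; [congr C1|]; solve_index.
    have -> : collapse i j = i by solve_index.
    by rewrite -Hi e2; have [->|->] : j = i.+1 \/ j = i.+2 by solve_index.
  split=> // j lt_j; case: (ltnP j i) => [lt|le].
    have := H2 j; rewrite lt => ->; [|solve_index..].
    by rewrite H3; [congr C0|]; solve_index.
  have := H2 j.+2; have -> : (if j.+2 < i then j.+2 else j.+2 - 2) = j by solve_index.
  by move=> ->; [rewrite H3; [congr C0|]|..]; solve_index.
- case=> H2 H1; split.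
    apply/LCusp_col_okP; split=> [j lt_j|].
      by rewrite H1; [congr C0|]; solve_index.
    by rewrite !H1; [congr C0|..]; solve_index.
  apply/RCusp_col_okP; rewrite size_LCusp; split=> [j lt_j n1 n2|].
    by rewrite H1 // H2; [congr C0|]; solve_index.
  by rewrite !H1; [congr C0|..]; solve_index.
Qed.

Lemma leq_card_cancel (T U : finType) (A : {set T}) (B : {set U}) (f : T -> U) (g : U -> T) :
  {in A, forall x, f x \in B} -> {in A, cancel f g} -> #|A| <= #|B|.
Proof.
move=> fAB fK; rewrite -(card_in_imset (can_in_inj fK)).
by apply/subset_leq_card/subsetP => _ /imsetP[x Ax ->]; apply: fAB.
Qed.

(** Used for both directions between a front and its stabilization. Beyond the common number of
    strands, both colours are [None]. *)
Lemma col_pullback (X : finType) D D' (F : point D' -> point D) (c : {ffun point D -> X}) i i' :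
  i <= size D' -> i' <= size D -> slice D' i = slice D i' ->
  (forall p, pk p = i -> pk (F p) = i' /\ pj (F p) = pj p) ->
  col [ffun p => c (F p)] i =1 col c i'.
Proof.
move=> le_i le_i' es eF m; case: (ltnP m (size (slice D' i))) => lt_m; last first.
  by rewrite !col_None //; [rewrite -es|]; lia.
rewrite col_inrange ffunE -col_point.
by have [|-> ->] := eF (mkpt le_i lt_m).
Qed.

Section Stab.
Variables (eps : bool) (k j : nat) (D : front).
Hypotheses (vD : valid_front D) (le_k : k <= size D) (lt_j : j < size (slice D k)).
Let b := nth false (slice D k) j.
Let E := stab eps k j D.
Let g1 := (zigzag eps b j).1.
Let g2 := (zigzag eps b j).2.

Lemma stab_cat : stab eps k j D = take k D ++ [:: g1; g2] ++ drop k D.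
Proof. by rewrite /stab /g1 /g2 /zigzag -/b; case: (eps == b). Qed.

Lemma size_stab : size E = (size D).+2.
Proof. by rewrite /E stab_cat size_cat /= size_takel // size_drop; lia. Qed.

Lemma stab_slice_lo i : i <= k -> slice E i = slice D i.
Proof.
move=> le_i; rewrite /slice /E stab_cat take_cat size_takel //.
case: ltnP => lt_ik; first by rewrite take_takel.
have -> : i = k by apply: anti_leq; rewrite le_i.
by rewrite subnn take0 cats0.
Qed.

Lemma stab_piece_lo i : i < k -> piece_at E i = piece_at D i.
Proof.
by move=> lt_i; rewrite /piece_at /E stab_cat nth_cat size_takel // lt_i nth_take.
Qed.

Lemma stab_piece_k : piece_at E k = g1.
Proof. by rewrite /piece_at /E stab_cat nth_cat size_takel // ltnn subnn. Qed.

Lemma stab_piece_k1 : piece_at E k.+1 = g2.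
Proof. by rewrite /piece_at /E stab_cat nth_cat size_takel // ifF ?subSnn //; lia. Qed.

Lemma stab_piece_hi i : k <= i -> piece_at E i.+2 = piece_at D i.
Proof.
move=> le_i; rewrite /piece_at /E stab_cat nth_cat size_takel // ifF; last by lia.
have -> : i.+2 - k = (i - k).+2 by lia.
by rewrite /= nth_drop subnKC.
Qed.

Lemma stab_slice_k1 : slice E k.+1 = apply_piece (slice D k) g1.
Proof. by rewrite sliceS ?size_stab ?stab_slice_lo ?stab_piece_k //; lia. Qed.

Lemma stab_slice_hi i : k <= i -> i <= size D -> slice E i.+2 = slice D i.
Proof.
elim: i => [|i IH] le_i lt_i.
  have e : k = 0 by lia.
  rewrite sliceS ?size_stab // -[1]/(0.+1) -e stab_piece_k1 stab_slice_k1 /g1 /g2.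
  by have := zigzag_slice eps lt_j; rewrite -/b; case: zigzag.
case: (ltngtP k i.+1) => [lt|lt|e]; last first.
- rewrite sliceS ?size_stab; last by lia.
  rewrite -e stab_piece_k1 stab_slice_k1 /g1 /g2.
  by have := zigzag_slice eps lt_j; rewrite -/b; case: zigzag.
- by lia.
- rewrite sliceS ?size_stab; last by lia.
  by rewrite stab_piece_hi ?IH -?sliceS //; lia.
Qed.

Lemma size_stab_k1 : size (slice E k.+1) = (size (slice D k)).+2.
Proof. by rewrite stab_slice_k1 /g1 /zigzag; case: ifP => _; rewrite size_LCusp. Qed.

Lemma stab_cases (P : nat -> Prop) :
  (forall i, i < k -> P i) -> P k -> P k.+1 -> (forall i, k <= i -> i < size D -> P i.+2) ->
  forall i, i < size E -> P i.
Proof.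
move=> Plo Pk Pk1 Phi i; rewrite size_stab => lt_i.
case: (ltngtP i k) => [/Plo //|lt_ki|-> //].
case: i lt_i lt_ki => [|i] //; case: i => [|i] lt_i lt_ki; first by have -> : 1 = k.+1 by lia.
by case: (eqVneq i.+1 k) => [->//|ne]; apply: Phi; lia.
Qed.

Lemma valid_stab : valid_front E.
Proof.
apply/andP; split; last first.
  by rewrite size_stab stab_slice_hi // valid_last.
apply/allP => i; rewrite mem_iota => /= lt_i; move: i lt_i.
apply: stab_cases => [i lt|||i le lt].
- by rewrite stab_slice_lo ?stab_piece_lo ?valid_piece //; lia.
- rewrite stab_slice_lo // stab_piece_k /g1 /zigzag; case: ifP => _ /=; lia.
- rewrite stab_slice_k1 stab_piece_k1 /g1 /g2 /zigzag; case: ifP => _ /=.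
    rewrite size_LCusp ?nth_LCusp ?(ltnW lt_j) // eqxx.
    rewrite !ifF; [|lia..].
    by rewrite subn2 /= -/b; case: (b) => /=; lia.
  rewrite size_LCusp ?nth_LCusp // ltnSn ltnn eqxx -/b; case: (b) => /=; lia.
- by rewrite stab_slice_hi ?stab_piece_hi ?valid_piece //; lia.
Qed.

Lemma count_stab (a : seq bool -> piece -> bool) :
  count (fun i => a (slice E i) (piece_at E i)) (iota 0 (size E)) =
  count (fun i => a (slice D i) (piece_at D i)) (iota 0 (size D)) +
  (a (slice D k) g1 + a (apply_piece (slice D k) g1) g2).
Proof.
have -> : size E = k + (2 + (size D - k)) by rewrite size_stab; lia.
rewrite -{2}(subnKC le_k) iotaD [iota 0 (k + _)]iotaD !count_cat !add0n /=.
rewrite stab_slice_lo // stab_piece_k stab_slice_k1 stab_piece_k1.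
have -> : count (fun i => a (slice E i) (piece_at E i)) (iota 0 k) =
          count (fun i => a (slice D i) (piece_at D i)) (iota 0 k).
  apply: eq_in_count => i; rewrite mem_iota => /= lt.
  by rewrite stab_slice_lo ?stab_piece_lo //; lia.
rewrite add0n; have -> : iota k.+2 (size D - k) = map (addn 2) (iota k (size D - k)).
  by rewrite -iotaDl.
rewrite count_map.
have -> : count (preim (addn 2) (fun i => a (slice E i) (piece_at E i))) (iota k (size D - k)) =
          count (fun i => a (slice D i) (piece_at D i)) (iota k (size D - k)).
  apply: eq_in_count => i; rewrite mem_iota => /andP[le lt] /=.
  by rewrite add2n stab_slice_hi ?stab_piece_hi //; lia.
lia.
Qed.

(** Both cusps of a zigzag are traversed in the same direction, upward for a negative stabilization
    and downward for a positive one; hence the change by 0 or 2. *)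
Lemma n_up_stab : n_up E = n_up D + (~~ eps).*2.
Proof.
rewrite /n_up count_stab /g1 /g2 /zigzag; congr addn; case: ifP => [/eqP->|ne] /=.
  rewrite nth_LCusp ?(ltnW lt_j) //.
  by rewrite ltnNge leqnSn (gtn_eqF (ltnSn j)) eqxx; case: (b).
by rewrite nth_LCusp // ltnSn -/b; move: ne; case: (b); case: (eps).
Qed.

Lemma n_down_stab : n_down E = n_down D + eps.*2.
Proof.
rewrite /n_down count_stab /g1 /g2 /zigzag; congr addn; case: ifP => [/eqP->|ne] /=.
  rewrite nth_LCusp ?(ltnW lt_j) //.
  by rewrite ltnNge leqnSn (gtn_eqF (ltnSn j)) eqxx; case: (b).
by rewrite nth_LCusp // ltnSn -/b; move: ne; case: (b); case: (eps).
Qed.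

Lemma collapse_le i : i <= size E -> collapse k i <= size D.
Proof. by rewrite size_stab => le_i; solve_index. Qed.

Lemma slice_collapse i : i <= size E -> i != k.+1 -> slice E i = slice D (collapse k i).
Proof.
rewrite size_stab => le_i ne; rewrite /collapse; case: leqP => lt_i.
  exact: stab_slice_lo.
have -> : i = (i - 2).+2 by lia.
rewrite stab_slice_hi; [|lia..].
by case: leqP => // lt; congr slice; lia.
Qed.

Lemma collapse_strand_lt i m : i <= size E -> m < size (slice E i) ->
  (if i == k.+1 then collapse j m else m) < size (slice D (collapse k i)).
Proof.
move=> le_i; case: eqP => [->|/eqP ne]; last by rewrite -slice_collapse.
rewrite size_stab_k1 => lt_m; have -> : collapse k k.+1 = k by solve_index.
by move: lt_m lt_j; solve_index.
Qed.

Definition collapse_point (p : point E) : point D :=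
  mkpt (collapse_le (pk_le p)) (collapse_strand_lt (pk_le p) (pj_lt p)).

Lemma expand_le i : i <= size D -> (if i <= k then i else i.+2) <= size E.
Proof. by rewrite size_stab; case: (leqP i k); lia. Qed.

Lemma slice_expand i : i <= size D -> slice E (if i <= k then i else i.+2) = slice D i.
Proof.
move=> le_i; case: leqP => le_ik; first exact: stab_slice_lo.
by rewrite stab_slice_hi // ltnW.
Qed.

Lemma expand_strand_lt i m : i <= size D -> m < size (slice D i) ->
  m < size (slice E (if i <= k then i else i.+2)).
Proof. by move=> le_i; rewrite slice_expand. Qed.

(** A section of [collapse_point] that avoids the slices [k.+1] and [k.+2] of [E]. *)
Definition expand_point (p : point D) : point E :=
  mkpt (expand_le (pk_le p)) (expand_strand_lt (pk_le p) (pj_lt p)).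

Lemma expand_pointK : cancel expand_point collapse_point.
Proof.
move=> p; apply: point_eq; rewrite !(pk_mkpt, pj_mkpt).
  by solve_index.
by rewrite ifF //; case: leqP; lia.
Qed.

(** * Topological colourings across a stabilization *)

Section StabColorings.
Variables (X : finType) (op : X -> X -> X).

Let pullE (c : {ffun point D -> X}) : {ffun point E -> X} := [ffun p => c (collapse_point p)].
Let pullD (c : {ffun point E -> X}) : {ffun point D -> X} := [ffun p => c (expand_point p)].

Lemma col_pullE c i : i <= size E -> i != k.+1 -> col (pullE c) i =1 col c (collapse k i).
Proof.
move=> le_i ne; apply: col_pullback => //; [exact: collapse_le|exact: slice_collapse|].
by move=> p ep; rewrite !(pk_mkpt, pj_mkpt) ep (negPf ne).
Qed.

Lemma col_pullE_k1 c m : m < (size (slice D k)).+2 ->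
  col (pullE c) k.+1 m = col c k (collapse j m).
Proof.
rewrite -size_stab_k1 => lt_m; have le_k1 : k.+1 <= size E by rewrite size_stab; lia.
rewrite col_inrange ffunE -col_point !(pk_mkpt, pj_mkpt) eqxx.
by have -> : collapse k k.+1 = k by solve_index.
Qed.

Lemma col_pullD c i : i <= size D -> col (pullD c) i =1 col c (if i <= k then i else i.+2).
Proof.
move=> le_i; apply: col_pullback => //; [exact: expand_le|by rewrite slice_expand|].
by move=> p ep; rewrite !(pk_mkpt, pj_mkpt) ep.
Qed.

Let zigzag_ok C0 C1 C2 :
  piece_col_ok op id id (slice D k) g1 C0 C1 /\
    piece_col_ok op id id (slice E k.+1) g2 C1 C2 <->
  (forall i, i < size (slice D k) -> C2 i = C0 i) /\
  (forall i, i < (size (slice D k)).+2 -> C1 i = C0 (collapse j i)).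
Proof.
have := zigzag_colP op eps b C0 C1 C2 lt_j.
by rewrite stab_slice_k1 /g1 /g2; case: zigzag.
Qed.

Lemma coloring_pullE (c : {ffun point D -> X}) :
  coloring_ok op id id c -> coloring_ok op id id (pullE c).
Proof.
move=> /coloring_okP ok; apply/coloring_okP.
have eqk i : i <= k -> col (pullE c) i =1 col c i.
  move=> le m; rewrite col_pullE ?size_stab; [|lia..].
  by congr (col c _ _); solve_index.
have eqk2 i : k <= i -> i <= size D -> col (pullE c) i.+2 =1 col c i.
  move=> le le2 m; rewrite col_pullE ?size_stab; [|lia..].
  by congr (col c _ _); solve_index.
have [] := (zigzag_ok (col (pullE c) k) (col (pullE c) k.+1) (col (pullE c) k.+2)).2.
  split=> m lt; first by rewrite [RHS]eqk // eqk2.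
  by rewrite [RHS]eqk // col_pullE_k1.
move=> ok1 ok2; apply: stab_cases => [i lt|||i le lt].
- rewrite stab_slice_lo ?stab_piece_lo ?(eq_piece_col _ _ _ _ _ (eqk i _) (eqk i.+1 _)) ?ok //; lia.
- by rewrite stab_slice_lo // stab_piece_k.
- by rewrite stab_piece_k1.
- rewrite stab_slice_hi ?stab_piece_hi; [|lia..].
  by rewrite (eq_piece_col _ _ _ _ _ (eqk2 i _ _) (eqk2 i.+1 _ _)) ?ok //; lia.
Qed.

Lemma zigzag_coloring (c : {ffun point E -> X}) : coloring_ok op id id c ->
  (forall m, m < size (slice D k) -> col c k.+2 m = col c k m) /\
  (forall m, m < (size (slice D k)).+2 -> col c k.+1 m = col c k (collapse j m)).
Proof.
move=> /coloring_okP ok; apply/zigzag_ok; split.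
  by have := ok k; rewrite stab_slice_lo // stab_piece_k; apply; rewrite size_stab; lia.
by have := ok k.+1; rewrite stab_piece_k1; apply; rewrite size_stab; lia.
Qed.

Lemma coloring_pullD (c : {ffun point E -> X}) :
  coloring_ok op id id c -> coloring_ok op id id (pullD c).
Proof.
move=> okc; have [zz _] := zigzag_coloring okc; have /coloring_okP ok := okc.
have eqk i : i <= k -> col (pullD c) i =1 col c i.
  by move=> le m; rewrite col_pullD ?le //; lia.
have eqk2 i : k <= i -> i <= size D -> col (pullD c) i =1 col c i.+2.
  move=> le le2 m; rewrite col_pullD //; case: leqP => // le3.
  (* Slice [k] of the pulled back colouring is read off slice [k] of [E], not [k.+2]; the equations
     of the zigzag identify the two. *)
  have -> : i = k by lia.
  case: (ltnP m (size (slice D k))) => [/zz //|ge].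
  have out : m < size (slice D k) = false by rewrite ltnNge ge.
  by rewrite !col_None ?stab_slice_hi ?stab_slice_lo ?out ?andbF.
apply/coloring_okP => i lt; case: (ltnP i k) => lt_i.
  rewrite (eq_piece_col _ _ _ _ _ (eqk i _) (eqk i.+1 _)); [|lia..].
  have := ok i; rewrite stab_slice_lo ?stab_piece_lo //; last lia.
  by apply; rewrite size_stab; lia.
rewrite (eq_piece_col _ _ _ _ _ (eqk2 i _ _) (eqk2 i.+1 _ _)); [|lia..].
have := ok i.+2; rewrite stab_slice_hi ?stab_piece_hi //; [|lia..].
by apply; rewrite size_stab; lia.
Qed.

(** [pullD] forgets the slices [k.+1] and [k.+2], but on a colouring the equations of the zigzag
    recover them from slice [k]. *)
Lemma pullDK (c : {ffun point E -> X}) : coloring_ok op id id c -> pullE (pullD c) = c.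
Proof.
move=> okc; have [zz1 zz2] := zigzag_coloring okc.
apply/ffunP => p; apply: Some_inj; rewrite -!col_point.
have le := pk_le p; have lt := pj_lt p.
case: (eqVneq (pk p) k.+1) => [ek|ne].
  rewrite ek in lt *; rewrite size_stab_k1 in lt.
  by rewrite col_pullE_k1 // col_pullD // leqnn zz2.
rewrite col_pullE // col_pullD ?collapse_le //.
case: (ltngtP (pk p) k.+2) => lt2.
- by congr (col c _ _); solve_index.
- by congr (col c _ _); solve_index.
- have -> : collapse k (pk p) = k by solve_index.
  rewrite leqnn lt2 zz1 //; move: lt; rewrite slice_collapse //.
  by have -> : collapse k (pk p) = k by solve_index.
Qed.

(** Pulling back along [collapse_point] and along [expand_point] are mutually inverse on colourings:
    topologically, the zigzag is pulled straight. *)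
Lemma ColTop_stab : ColTop op E = ColTop op D.
Proof.
apply/eqP; rewrite eqn_leq; apply/andP; split.
  apply: (leq_card_cancel (f := pullD) (g := pullE)) => c; rewrite !inE.
    exact: coloring_pullD.
  exact: pullDK.
apply: (leq_card_cancel (f := pullE) (g := pullD)) => c; rewrite !inE.
  exact: coloring_pullE.
by move=> _; apply/ffunP => p; rewrite !ffunE expand_pointK.
Qed.

End StabColorings.

End Stab.

(** * Existence of potentials *)

(** [f] is a single cycle, and the prescribed increments [b x - a x] sum to zero around it, so
    adding them up from a base point is consistent on return. *)
Lemma cycle_potential (T : finType) (f : T -> T) (a b : T -> nat) :
  injective f -> (forall x y, fconnect f x y) -> \sum_x a x = \sum_x b x ->
  exists h : T -> nat, forall x, h (f x) + a x = h x + b x.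
Proof.
move=> f_inj f_conn sum_ab; case: (pickP T) => [x0 _|T0]; last by exists (fun=> 0) => x; have := T0 x.
pose N := fingraph.order f x0; pose y i := iter i f x0.
have yN : y N = x0 by apply: iter_order.
have sumE (F : T -> nat) : \sum_x F x = \sum_(0 <= i < N) F (y i).
  transitivity (\sum_(x <- orbit f x0) F x).
    rewrite [RHS]big_uniq ?orbit_uniq //; apply: eq_bigl => x.
    by rewrite -fconnect_orbit f_conn.
  rewrite (big_nth x0) size_orbit; apply: eq_big_nat => i lt_i.
  by rewrite /orbit nth_traject.
pose n x := findex f x0 x.
have yn x : y (n x) = x by apply: iter_findex.
have lt_n x : n x < N by apply: findex_max.
have fy x : f x = y (n x).+1 by rewrite /y iterS -/(y _) yn.
(* Going round the cycle from [x0], add [b] on the way and [a] on what remains; this keeps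
   [h] in [nat]. *)
exists (fun x => \sum_(0 <= i < n x) b (y i) + \sum_(n x <= i < N) a (y i)) => x.
case: (ltngtP (n x).+1 N) => [lt|lt|e].
- have -> : n (f x) = (n x).+1 by rewrite fy [LHS]findex_iter.
  rewrite big_nat_recr //= [in RHS](big_ltn (lt_n x)) yn; lia.
- by have := lt_n x; lia.
(* The cycle closes here: the value at [x0] is the total of [a], which [sum_ab] exchanges for the
   total of [b]. *)
- have -> : n (f x) = 0 by rewrite fy e yN /n findex0.
  move: sum_ab; rewrite !sumE [\sum_(0 <= i < 0) _]big_geq // -e
    [\sum_(n x <= i < _) _]big_nat1 [\sum_(0 <= i < _) b _]big_nat_recr //= yn; lia.
Qed.

(** * Walking along the knot *)

Section Walk.

(** The piece [g] lies between slices [k] and [k.+1]. [step_right] enters it from slice [k],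
    [step_left] from slice [k.+1]. At a cusp facing the walker, the step leads to the other branch
    on the same slice. *)
Definition step_right g k j :=
  match g with
  | LCusp i _ => (k.+1, if j < i then j else j.+2)
  | RCusp i => if j == i then (k, i.+1) else if j == i.+1 then (k, i)
               else (k.+1, if j < i then j else j - 2)
  | Cross i => (k.+1, swap i j)
  end.

Definition step_left g k j :=
  match g with
  | LCusp i _ => if j == i then (k.+1, i.+1) else if j == i.+1 then (k.+1, i)
                 else (k, if j < i then j else j - 2)
  | RCusp i => (k, if j < i then j else j.+2)
  | Cross i => (k, swap i j)
  end.

(** Records how a step is undone: after a turn at a cusp the orientation is reversed and the same
    kind of step leads back; after passing the piece the orientation is kept and the opposite step
    leads back. *)
Variant right_spec s g k j : nat * nat -> Prop :=
  | RightTurn j' of j' < size s & nth false s j' = ~~ nth false s j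
      & step_right g k j' = (k, j) : right_spec s g k j (k, j')
  | RightLink j' of j' < size (apply_piece s g)
      & nth false (apply_piece s g) j' = nth false s j
      & step_left g k j' = (k, j) : right_spec s g k j (k.+1, j').

Lemma step_rightP s g k j : piece_ok s g -> j < size s ->
  right_spec s g k j (step_right g k j).
Proof.
case: g => [i b|i|i] /= ok lt_j.
- apply: RightLink; rewrite ?size_LCusp ?nth_LCusp //=.
  + by solve_index.
  + by case: (ltnP j i) => [->//|le]; rewrite !ifF; [congr nth| | |]; solve_index.
  + by case: (ltnP j i) => lt /=; (rewrite ifF; [rewrite ifF; [congr pair|]|]); solve_index.
- case/andP: ok => ok ne; case: eqP => [->|/eqP n1].
    apply: RightTurn; rewrite //=.
      by move: ne; do 2![case: nth].
    by rewrite ifF ?eqxx //; lia.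
  case: eqP => [->|/eqP n2].
    apply: RightTurn; rewrite //=; first by lia.
      by move: ne; do 2![case: nth].
    by rewrite eqxx.
  apply: RightLink; rewrite ?size_RCusp ?nth_RCusp //=.
  + by solve_index.
  + by congr nth; solve_index.
  + by congr pair; solve_index.
- apply: RightLink; rewrite ?size_Cross ?nth_Cross //= /swap.
  + by solve_index.
  + by congr nth; solve_index.
  + by congr pair; solve_index.
Qed.

Variant left_spec s g k j : nat * nat -> Prop :=
  | LeftTurn j' of j' < size (apply_piece s g)
      & nth false (apply_piece s g) j' = ~~ nth false (apply_piece s g) j
      & step_left g k j' = (k.+1, j) : left_spec s g k j (k.+1, j')
  | LeftLink j' of j' < size s
      & nth false s j' = nth false (apply_piece s g) j
      & step_right g k j' = (k.+1, j) : left_spec s g k j (k, j').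

Lemma step_leftP s g k j : piece_ok s g -> j < size (apply_piece s g) ->
  left_spec s g k j (step_left g k j).
Proof.
case: g => [i b|i|i] /= ok.
- rewrite size_LCusp => lt_j; case: eqP => [->|/eqP n1].
    apply: LeftTurn; rewrite ?size_LCusp ?nth_LCusp //=.
    + by rewrite [i.+1 < i]ltnNge leqnSn (gtn_eqF (ltnSn i)) !eqxx ltnn.
    + by rewrite ifF ?eqxx //; lia.
  case: eqP => [->|/eqP n2].
    apply: LeftTurn; rewrite ?size_LCusp ?nth_LCusp //=; first by lia.
    + by rewrite [i.+1 < i]ltnNge leqnSn (gtn_eqF (ltnSn i)) !eqxx ltnn negbK.
    + by rewrite eqxx.
  apply: LeftLink; rewrite ?nth_LCusp //=.
  + by solve_index.
  + by rewrite (negPf n1) (negPf n2); case: ltnP.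
  + by congr pair; solve_index.
- case/andP: ok => ok ne; rewrite size_RCusp // => lt_j.
  apply: LeftLink; rewrite ?nth_RCusp //=.
  + by solve_index.
  + by case: (ltnP j i) => lt /=; (rewrite ifF; [rewrite ifF; [congr pair|]|]); solve_index.
- rewrite size_Cross // => lt_j; apply: LeftLink; rewrite ?nth_Cross //= /swap.
  + by solve_index.
  + by congr pair; solve_index.
Qed.

Variable D : front.
Hypothesis vD : valid_front D.

(* Both successors follow the knot along ([next_coord]) or against ([prev_coord]) its
   orientation, the two branches of a cusp being adjacent. *)
Definition next_coord k j : nat * nat :=
  if nth false (slice D k) j then step_right (piece_at D k) k j
  else step_left (piece_at D k.-1) k.-1 j.

Definition prev_coord k j : nat * nat :=
  if nth false (slice D k) j then step_left (piece_at D k.-1) k.-1 j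
  else step_right (piece_at D k) k j.

(** The walk never runs out of pieces, because the first and last slices are empty. [prev_coord]
    undoes it because orientation reverses exactly at turns, so the stored orientation selects the
    step that leads back. *)
Lemma next_coordP k j : k <= size D -> j < size (slice D k) ->
  let: (k', j') := next_coord k j in
  [/\ k' <= size D, j' < size (slice D k') & prev_coord k' j' = (k, j)].
Proof.
move=> le_k lt_j; rewrite /next_coord; case o: nth.
  have lt_k : k < size D.
    by rewrite ltn_neqAle le_k andbT; apply: contraTneq lt_j => ->; rewrite valid_last.
  case: (step_rightP k (valid_piece vD lt_k) lt_j) => j' lt_j' o' e.
    by split=> //; rewrite /prev_coord o' o.
  by split; rewrite // ?sliceS // /prev_coord sliceS // o' o.
case: k le_k lt_j o => [|k] lt_k lt_j o; first by rewrite slice0 in lt_j.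
rewrite sliceS // in lt_j o.
case: (step_leftP k (valid_piece vD lt_k) lt_j) => j' lt_j' o' e.
  by split; rewrite // ?sliceS // /prev_coord sliceS // o' o.
by split=> //; rewrite /prev_coord ?(ltnW lt_k) // o' o.
Qed.

Lemma next_le (p : point D) : (next_coord (pk p) (pj p)).1 <= size D.
Proof. by have := next_coordP (pk_le p) (pj_lt p); case: next_coord => k j []. Qed.

Lemma next_lt (p : point D) : (next_coord (pk p) (pj p)).2 < size (slice D (next_coord (pk p) (pj p)).1).
Proof. by have := next_coordP (pk_le p) (pj_lt p); case: next_coord => k j []. Qed.

Definition next_point (p : point D) : point D := mkpt (next_le p) (next_lt p).

Lemma next_pointE p q : next_coord (pk p) (pj p) = (pk q, pj q) -> next_point p = q.
Proof. by move=> e; apply: point_eq; rewrite (pk_mkpt, pj_mkpt) e. Qed.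

Lemma next_point_inj : injective next_point.
Proof.
move=> p q e.
have coordK r : prev_coord (pk (next_point r)) (pj (next_point r)) = (pk r, pj r).
  have := next_coordP (pk_le r) (pj_lt r).
  by rewrite pk_mkpt pj_mkpt; case: next_coord => k j [].
by have := coordK p; rewrite e coordK => -[ek ej]; apply: point_eq.
Qed.

(** A step that stays on its slice traverses a cusp; [T] compares the branch left with the branch
    reached. *)
Definition turn (T : rel nat) k j :=
  let: (k', j') := next_coord k j in (k' == k) && T j j'.
Definition up_turn := turn (fun j j' => j < j').
Definition down_turn := turn (fun j j' => j' < j).

(** The value 0 off the front is a dummy: on a valid front, potentials only relate actual
    strands. *)
Definition strand_fun (h : point D -> nat) k j := if pt D k j is Some p then h p else 0.

Lemma strand_funE h k j (le_k : k <= size D) (lt_j : j < size (slice D k)) :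
  strand_fun h k j = h (mkpt le_k lt_j).
Proof. by rewrite /strand_fun ptE. Qed.

(* [z = 1] gives Maslov potentials, [z = 0] functions that are constant along the knot. *)
Section PotentialSteps.
Variables (z : nat) (h : point D -> nat).
Hypothesis h_next : forall p, h (next_point p) + z * down_turn (pk p) (pj p) =
                              h p + z * up_turn (pk p) (pj p).

Lemma strand_fun_next k j k' j' : k <= size D -> j < size (slice D k) ->
  next_coord k j = (k', j') ->
  strand_fun h k' j' + z * ((k' == k) && (j' < j)) =
  strand_fun h k j + z * ((k' == k) && (j < j')).
Proof.
move=> le_k lt_j e; have := next_coordP le_k lt_j; rewrite e => -[le_k' lt_j' _].
have := h_next (mkpt le_k lt_j); rewrite /down_turn /up_turn /turn pk_mkpt pj_mkpt e.
rewrite !strand_funE.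
by have -> : next_point (mkpt le_k lt_j) = mkpt le_k' lt_j' by apply: next_pointE.
Qed.

(** For a strand pointing right, this is the equation of [h_next] at [(k, j)]. For one pointing
    left, it is the equation at [(k.+1, j')], whose successor is [(k, j)]. *)
Lemma strand_fun_link k j j' : k < size D -> j < size (slice D k) ->
  step_right (piece_at D k) k j = (k.+1, j') ->
  strand_fun h k.+1 j' = strand_fun h k j.
Proof.
move=> lt_k lt_j e.
case o: (nth false (slice D k) j).
  have := @strand_fun_next k j k.+1 j'; rewrite /next_coord o e => /(_ (ltnW lt_k) lt_j erefl).
  by rewrite gtn_eqF //= muln0 !addn0.
case: (step_rightP k (valid_piece vD lt_k) lt_j) e => j'' lt_j'' o' e' []; first by lia.
move=> ej; rewrite -{}ej.
have := @strand_fun_next k.+1 j'' k j; rewrite sliceS // /next_coord sliceS // o' o /= => H.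
by have := H lt_k lt_j'' e'; rewrite ltn_eqF //= muln0 !addn0.
Qed.

(** At a cusp, the equation used is that of the branch oriented towards the cusp: the lower one if
    the traversal is upward, the upper one otherwise. Both cases give the same jump [z]. *)
Lemma potential_strand_fun : potential z D (strand_fun h).
Proof.
move=> k lt_k; have ok := valid_piece vD lt_k.
have link := @strand_fun_link k _ _ lt_k.
case g: (piece_at D k) ok link => [i b|i|i] /= ok link.
- split; first by move=> j lt_j; apply: link.
  have s1 := sliceS lt_k; rewrite g in s1.
  have lt_i : i < size (slice D k.+1) by rewrite s1 size_LCusp; lia.
  have lt_i1 : i.+1 < size (slice D k.+1) by rewrite s1 size_LCusp; lia.
  have gt_i : (i.+1 < i) = false by rewrite ltnNge leqnSn.
  case: (b) s1 => s1.
    have e : next_coord k.+1 i.+1 = (k.+1, i).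
      by rewrite /next_coord s1 nth_LCusp // gt_i (gtn_eqF (ltnSn i)) eqxx /= g /= (gtn_eqF (ltnSn i)) eqxx.
    by have := strand_fun_next lt_k lt_i1 e; rewrite eqxx ltnSn gt_i muln1 muln0 addn0.
  have e : next_coord k.+1 i = (k.+1, i.+1).
    by rewrite /next_coord s1 nth_LCusp // ltnn eqxx /= g /= eqxx.
  by have := strand_fun_next lt_k lt_i e; rewrite eqxx ltnSn gt_i muln1 muln0 addn0.
- case/andP: ok => ok ne; split.
    move=> j lt_j n1 n2; apply: link => //.
    by rewrite (negPf n1) (negPf n2).
  have gt_i : (i.+1 < i) = false by rewrite ltnNge leqnSn.
  case o: (nth false (slice D k) i) ne => ne.
    have e : next_coord k i = (k, i.+1) by rewrite /next_coord o g /= eqxx.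
    have := strand_fun_next (ltnW lt_k) (ltnW ok) e.
    by rewrite eqxx ltnSn gt_i muln1 muln0 addn0.
  have e : next_coord k i.+1 = (k, i).
    have o1 : nth false (slice D k) i.+1 by move: ne; case: nth.
    by rewrite /next_coord o1 g /= (gtn_eqF (ltnSn i)) eqxx.
  by have := strand_fun_next (ltnW lt_k) ok e; rewrite eqxx ltnSn gt_i muln1 muln0 addn0.
- split; last split.
  + by move=> j lt_j n1 n2; apply: link; rewrite // /swap (negPf n1) (negPf n2).
  + by apply: link => //; rewrite /swap eqxx gtn_eqF.
  + by apply: link; rewrite ?(ltnW ok) // /swap eqxx.
Qed.

End PotentialSteps.

End Walk.

(** * Counting cusps along the walk *)

Section TurnSums.

Lemma sum_nat_at n i (c : bool) : i < n -> \sum_(j < n) ((j == i :> nat) && c) = c.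
Proof.
move=> lt_i; rewrite (bigD1 (Ordinal lt_i)) //= eqxx big1 ?addn0 // => j.
by rewrite -val_eqE /= => /negPf ->.
Qed.

Lemma sum_point D (F : nat -> nat -> nat) :
  \sum_(p : point D) F (pk p) (pj p) =
  \sum_(k < (size D).+1) \sum_(j < size (slice D k)) F k j.
Proof.
transitivity (\sum_(k < (size D).+1) \sum_(j < (size D).*2.+1 | j < size (slice D k)) F k j).
  rewrite pair_big_dep /= (reindex_omap (val : point D -> _) insub) => [|[k j] lt_j] /=.
    by apply: eq_bigl => p; rewrite (valP p) valK eqxx.
  by rewrite insubT.
apply: eq_bigr => k _; rewrite (big_ord_widen_cond (size D).*2.+1 xpredT (F k)) //.
by have := size_slice_le (ltn_ord k : k <= size D); have := ltn_ord k; lia.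
Qed.

Variable T : rel nat.

Lemma sum_step_right s g k : piece_ok s g ->
  \sum_(j < size s) (nth false s j &&
     (let: (k', j') := step_right g k j in (k' == k) && T j j')) =
  if g is RCusp i then (nth false s i && T i i.+1) + (nth false s i.+1 && T i.+1 i) else 0.
Proof.
case: g => [i b|i|i] /= ok; try by apply: big1 => j _; rewrite gtn_eqF ?andbF.
case/andP: ok => ok _.
rewrite -(sum_nat_at _ (ltnW ok)) -(sum_nat_at (_ && T i.+1 i) ok) -big_split /=.
apply: eq_bigr => j _; case: eqP => [->|_].
  by rewrite eqxx (ltn_eqF (ltnSn i)) addn0.
case: eqP => [->|_]; first by rewrite eqxx.
by rewrite gtn_eqF ?andbF.
Qed.

Lemma sum_step_left s g k : piece_ok s g ->
  \sum_(j < size (apply_piece s g)) (~~ nth false (apply_piece s g) j &&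
     (let: (k', j') := step_left g k j in (k' == k.+1) && T j j')) =
  if g is LCusp i b then (~~ b && T i i.+1) + (b && T i.+1 i) else 0.
Proof.
case: g => [i b|i|i] /= ok; try by apply: big1 => j _; rewrite ltn_eqF ?andbF.
have lt_i1 : i.+1 < size (apply_piece s (LCusp i b)) by rewrite size_LCusp.
rewrite -(sum_nat_at (_ && T i i.+1) (ltnW lt_i1)) -(sum_nat_at (_ && T i.+1 i) lt_i1) -big_split /=.
apply: eq_bigr => j _; rewrite nth_LCusp //; case: (eqVneq (j : nat) i) => [->|_].
  by rewrite ltnn eqxx (ltn_eqF (ltnSn i)) addn0.
case: (eqVneq (j : nat) i.+1) => [->|_]; last by rewrite ltn_eqF ?andbF.
by rewrite [i.+1 < i]ltnNge leqnSn eqxx negbK.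
Qed.

(** Strands pointing right face the piece after their slice, those pointing left the piece before
    it. Shifting the second family ([L]) by one slice indexes both sums by pieces; the leftover
    terms belong to the empty end slices. *)
Lemma sum_turns D : valid_front D ->
  \sum_(p : point D) turn D T (pk p) (pj p) =
  \sum_(k < size D)
    match piece_at D k with
    | LCusp i b => (~~ b && T i i.+1) + (b && T i.+1 i)
    | RCusp i => (nth false (slice D k) i && T i i.+1) +
                 (nth false (slice D k) i.+1 && T i.+1 i)
    | Cross _ => 0
    end.
Proof.
move=> vD; rewrite (sum_point D (turn D T)).
pose R k := \sum_(j < size (slice D k)) (nth false (slice D k) j &&
  (let: (k', j') := step_right (piece_at D k) k j in (k' == k) && T j j')).
pose L k := \sum_(j < size (slice D k)) (~~ nth false (slice D k) j &&
  (let: (k', j') := step_left (piece_at D k.-1) k.-1 j in (k' == k) && T j j')).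
transitivity (\sum_(k < (size D).+1) (R k + L k)).
  apply: eq_bigr => k _; rewrite -big_split; apply: eq_bigr => j _.
  rewrite /turn /next_coord; case: (step_right _ _ _) => ? ?; case: (step_left _ _ _) => ? ?.
  by case: nth; rewrite /= ?addn0.
rewrite big_split /= big_ord_recr /= [X in _ + X]big_ord_recl /=.
have -> : R (size D) = 0 by apply: big1 => -[j lt_j] _; exfalso; rewrite valid_last in lt_j.
have -> : L 0 = 0 by apply: big1 => -[j lt_j] _; exfalso; rewrite slice0 in lt_j.
rewrite addn0 add0n -big_split /=; apply: eq_bigr => k _.
have ok := valid_piece vD (ltn_ord k).
rewrite /R sum_step_right // /L /bump /= add1n /= sliceS // sum_step_left //.
by case: piece_at => *; rewrite ?addn0 ?add0n.
Qed.

End TurnSums.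

Lemma count_iota_sum (a : nat -> bool) n : count a (iota 0 n) = \sum_(k < n) a k.
Proof.
elim: n => [|n IH]; first by rewrite big_ord0.
by rewrite big_ord_recr -IH -[X in iota 0 X]addn1 iotaD count_cat /= addn0.
Qed.

Lemma sum_up_turn D : valid_front D ->
  \sum_(p : point D) up_turn D (pk p) (pj p) = n_up D.
Proof.
move=> vD; rewrite /up_turn sum_turns // /n_up count_iota_sum.
apply: eq_bigr => k _; case: piece_at => [i b|i|i] //=;
  by rewrite ltnSn [i.+1 < i]ltnNge leqnSn andbT andbF addn0.
Qed.

Lemma sum_down_turn D : valid_front D ->
  \sum_(p : point D) down_turn D (pk p) (pj p) = n_down D.
Proof.
move=> vD; rewrite /down_turn sum_turns // /n_down count_iota_sum.
apply: eq_bigr => k _; have := valid_piece vD (ltn_ord k).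
case: piece_at => [i b|i|i] //=;
  rewrite ltnSn [i.+1 < i]ltnNge leqnSn andbT andbF add0n // => /andP[_].
by case: nth; case: nth.
Qed.

(** * Connectedness through two-valued colourings *)

Definition triv_op (a b : bool) := a.

(** The hypothesis is there because [oop] returns [None] when the over-strand has no colour, even
    though [triv_op] ignores that colour. *)
Lemma triv_Cross_col_okP s i C0 C1 : C0 i.+1 != None ->
  reflect ((forall j, j < size s -> j != i -> j != i.+1 -> C1 j = C0 j) /\
           C1 i = C0 i.+1 /\ C1 i.+1 = C0 i)
          (piece_col_ok triv_op id id s (Cross i) C0 C1).
Proof.
move=> ne; have oopE a : oop triv_op a (C0 i.+1) = a.
  by case: (C0 i.+1) ne a => [y|//] _ [].
rewrite /= !oopE [C0 i == _]eq_sym if_same -andbA.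
apply: (iffP and3P) => [[/allP H /eqP e1 /eqP e2]|[H [e1 e2]]].
  split=> // j lt n1 n2; apply/eqP; have := H j.
  by rewrite mem_iota (negPf n1) (negPf n2); exact.
split; [|exact/eqP..]; apply/allP => j; rewrite mem_iota => lt.
by case: eqP => //= /eqP n1; case: eqP => //= /eqP n2; apply/eqP/H.
Qed.

Section Connectivity.
Variable D : front.
Hypothesis vD : valid_front D.
Implicit Types c : {ffun point D -> bool}.

Lemma col_neq_None c k j : k <= size D -> j < size (slice D k) -> col c k j != None.
Proof. by move=> le_k lt_j; rewrite col_inrange. Qed.

Lemma link_step_col c k j k' j' : coloring_ok triv_op id id c ->
  link_step D k j k' j' -> col c k' j' = col c k j.
Proof.
move=> /coloring_okP ok /andP[/andP[/andP[/eqP -> lt_k] lt_j]].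
have := ok k lt_k; have := valid_piece vD lt_k.
case: piece_at => [i b|i|i] pok.
- by case/LCusp_col_okP => H _ /eqP ->; apply: H.
- by case/RCusp_col_okP => H _ /andP[/andP[n1 n2] /eqP ->]; apply: H.
- have ne : col c k i.+1 != None by apply: col_neq_None; rewrite // ltnW.
  case/(triv_Cross_col_okP _ _ ne) => H [e1 e2] /eqP ->.
  by case: eqP => [->//|/eqP n1]; case: eqP => [->//|/eqP n2]; apply: H.
Qed.

Lemma cusp_pair_col c k j j' : coloring_ok triv_op id id c -> k <= size D ->
  cusp_pair D k j j' -> col c k j = col c k j'.
Proof.
move=> /coloring_okP ok le_k /orP[] /andP[lt_k].
  case: k lt_k le_k => // k _ lt_k; rewrite /=; have := ok k lt_k.
  by case: piece_at => // i b /LCusp_col_okP[_ e] /andP[/eqP-> /eqP->].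
have := ok k lt_k.
by case: piece_at => // i /RCusp_col_okP[_ e] /andP[/eqP-> /eqP->].
Qed.

Lemma adj_coloring c p q : coloring_ok triv_op id id c -> adj p q -> c p = c q.
Proof.
move=> ok; rewrite /adj -!/(pk _) -!/(pj _) => a.
apply: Some_inj; rewrite -!col_point; case/or4P: a => [a|a|/andP[/eqP e a]|/andP[/eqP e a]].
- by rewrite (link_step_col ok a).
- by rewrite (link_step_col ok a).
- by rewrite -e; apply: cusp_pair_col => //; apply: pk_le.
- by rewrite -e; apply/esym/cusp_pair_col => //; apply: pk_le.
Qed.

(** A colouring is constant along [adj], so its value at one point determines it; a front without
    points has a single colouring. *)
Lemma ColTop_connected : (forall p q : point D, connect (@adj D) p q) ->
  ColTop triv_op D <= 2.
Proof.
move=> conn; rewrite -card_bool -cardsT.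
case: (pickP (fun _ : point D => true)) => [p0 _|D0].
  apply: (leq_card_cancel (f := fun c => c p0) (g := fun b => [ffun=> b])) => c; first by rewrite inE.
  rewrite inE => ok; apply/ffunP => q; rewrite ffunE.
  have cl : closed (@adj D) [pred q | c q == c p0].
    by move=> p' q' a; rewrite !inE (adj_coloring ok a).
  have := closed_connect cl (conn p0 q); rewrite !inE eqxx => /esym/eqP ->.
  by [].
apply: (leq_card_cancel (f := fun c => true) (g := fun b => [ffun=> b])) => c; first by rewrite inE.
by move=> _; apply/ffunP => q; have := D0 q.
Qed.

(** Read in [nat], an invariant function is a potential with [z = 0], and its potential steps are
    the local conditions of a trivial colouring. *)
Lemma invariant_coloring c : (forall p, c (next_point vD p) = c p) ->
  coloring_ok triv_op id id c.
Proof.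
move=> c_next; pose h p : nat := c p.
have pot := @potential_strand_fun D vD 0 h.
have {}pot : potential 0 D (strand_fun h).
  by apply: pot => p; rewrite !mul0n /h c_next.
have eqcol k j k' j' : k <= size D -> j < size (slice D k) -> k' <= size D ->
    j' < size (slice D k') -> strand_fun h k j = strand_fun h k' j' -> col c k j = col c k' j'.
  move=> le_k lt_j le_k' lt_j'; rewrite !strand_funE !col_inrange /h.
  by case: (c _); case: (c _).
apply/coloring_okP => k lt_k; have := pot k lt_k; have := sliceS lt_k.
have := valid_piece vD lt_k; have le_k := ltnW lt_k.
case: piece_at => [i b|i|i] pok s1 [H e].
- have sz : size (slice D k.+1) = (size (slice D k)).+2 by rewrite s1 size_LCusp.
  rewrite addn0 in e; apply/LCusp_col_okP; split=> [j lt_j|].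
    by apply: eqcol; rewrite ?H // sz; solve_index.
  by apply: eqcol; rewrite // sz; move: pok => /=; lia.
- case/andP: (pok) => ok1 _.
  have sz : size (slice D k.+1) = size (slice D k) - 2 by rewrite s1 size_RCusp.
  rewrite addn0 in e; apply/RCusp_col_okP; split=> [j lt_j n1 n2|].
    by apply: eqcol; rewrite ?H // sz; solve_index.
  by apply: eqcol; rewrite // ltnW.
- have sz : size (slice D k.+1) = size (slice D k) by rewrite s1 size_Cross.
  move: pok => /= pok; case: e => e1 e2.
  apply/triv_Cross_col_okP; first exact: col_neq_None.
  split=> [j lt_j n1 n2|]; first by apply: eqcol; rewrite ?H // sz.
  by split; apply: eqcol; rewrite // ?sz // ltnW.
Qed.

(** If [q] were off the orbit of [p], the two constants and the indicator of that orbit would be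
    three distinct colourings. *)
Lemma next_point_connected : ColTop triv_op D <= 2 ->
  forall p q, fconnect (next_point vD) p q.
Proof.
move=> le2 p q; apply: contraLR le2 => npq; rewrite -ltnNge.
pose S := [ffun x => fconnect (next_point vD) p x].
pose cs := [:: [ffun=> false]; [ffun=> true]; S].
have cs_uniq : uniq cs.
  have ne (c c' : {ffun point D -> bool}) x : c x != c' x -> c != c'.
    by apply: contraNneq => ->.
  rewrite /= !inE negb_or (ne _ _ p) ?ffunE //=.
  by rewrite (ne _ _ p) ?(ne _ _ q) // !ffunE ?connect0 // (negPf npq).
rewrite -(card_uniqP cs_uniq : _ = 3); apply/subset_leq_card/subsetP => c.
rewrite !inE => /or3P[]/eqP->; apply: invariant_coloring => x; rewrite !ffunE //.
by rewrite -same_fconnect1_r //; apply: next_point_inj.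
Qed.

Lemma exists_potential : ColTop triv_op D <= 2 -> n_up D = n_down D ->
  exists h, potential 1 D h.
Proof.
move=> le2 e.
have [h hP] : exists h : point D -> nat, forall p, h (next_point vD p) + down_turn D (pk p) (pj p)
    = h p + up_turn D (pk p) (pj p).
  apply: (@cycle_potential _ _ (fun p => down_turn D (pk p) (pj p) : nat)
                               (fun p => up_turn D (pk p) (pj p) : nat)).
  - exact: next_point_inj.
  - exact: next_point_connected.
  - by rewrite sum_up_turn // sum_down_turn.
by exists (strand_fun h); apply: (potential_strand_fun (vD := vD)) => p; rewrite !mul1n.
Qed.

(** Makes the division by 2 in [rot_num] exact. A left cusp adds two strands and one cusp, a right
    cusp trades two strands for one cusp, so the number of strands plus twice the number of cusps
    stays a multiple of 4; at the end no strand is left. *)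
Lemma cusps_even : odd (n_up D + n_down D) = false.
Proof.
pose cusps m := \sum_(k < m)
  (piece_up (slice D k) (piece_at D k) + piece_down (slice D k) (piece_at D k)).
have inv m : m <= size D -> 4 %| size (slice D m) + 2 * cusps m.
  elim: m => [|m IH] lt_m; first by rewrite slice0 /cusps big_ord0.
  have := IH (ltnW lt_m); have := valid_piece vD lt_m.
  rewrite sliceS // {2}/cusps big_ord_recr /= -/(cusps m).
  case: piece_at => [i b|i|i] /= pok.
  - by rewrite size_LCusp; case: b => /=; lia.
  - by case/andP: pok => pok _; rewrite size_RCusp //; case: nth => /=; lia.
  - by rewrite size_Cross //; lia.
rewrite /n_up /n_down !count_iota_sum -big_split -/(cusps _).
by have := inv _ (leqnn _); rewrite valid_last // add0n; lia.
Qed.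

End Connectivity.

(** * Balancing the cusps by stabilization *)

Lemma stabilized_invariants eps n D D' : stabilized eps n D D' -> valid_front D ->
  [/\ valid_front D', n_up D' = n_up D + n * (~~ eps).*2,
      n_down D' = n_down D + n * eps.*2 &
      forall (X : finType) (op : X -> X -> X), ColTop op D' = ColTop op D].
Proof.
elim=> [D0|m D0 D1 k j _ IH le_k lt_j] vD; first by split=> //; rewrite addn0.
have [vD1 eu ed ec] := IH vD; split.
- exact: valid_stab.
- by rewrite n_up_stab // eu; lia.
- by rewrite n_down_stab // ed; lia.
- by move=> X op; rewrite ColTop_stab.
Qed.

Theorem theorem5p2 (X : finType) (op : X -> X -> X) (u d : X -> X)
    (D D' : front) :
  is_GL_quandle op u d ->
  knot_front D ->
  stabilized (rot_num D < 0)%R (absz (rot_num D)) D D' ->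
  ColLeg op u d D' = ColTop op D.
Proof.
move=> GL /andP[/andP[vD _] /forallP conn] stD.
have [vD' eu ed ec] := stabilized_invariants stD vD.
have le2 : ColTop triv_op D' <= 2.
  by rewrite ec; apply: ColTop_connected => // p q; move/forallP: (conn p).
have balanced : n_up D' = n_down D'.
  (* By parity, [n_down D - n_up D] is exactly twice the rotation number [r]. The stabilizations add
     [2|r|] downward cusps if [r < 0] and [2|r|] upward ones otherwise. *)
  rewrite eu ed; have := cusps_even vD; rewrite /rot_num.
  by case: (boolP (_ < 0)%R) => lt /=; lia.
have [h hP] := exists_potential vD' le2 balanced.
by rewrite (ColLeg_maslov GL hP) ec.
Qed.
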